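(* Let $m,n,s\in\mathbb{N}$, and let $L=\bigoplus_{y\in Y}L_y$ be a grading of a Lie algebra $L$ over a field by a set $Y$ of size $|Y|=n$. Suppose that at least one of the following two conditions holds. (a) All the homogeneous components $L_y$ act $m$-nilpotently: $\operatorname{ad}_{L_y}^m(L)=\{0\}$ for every $y\in Y$. (b) All the homogeneous elements are $m$-Engel, i.e. $\operatorname{ad}_{v}^m(L)=\{0\}$ for every $y\in Y$ and every $v\in L_y$, and the characteristic of the base field of $L$ does not divide $m!$. Then $$L^{1+n^s\cdot m^s}\subseteq L^{(s)}.$$
   Context: $\mathbb{N}$ denotes the positive integers. A grading of a Lie algebra $L$ by a finite set $Y$ is a decomposition $L=\bigoplus_{y\in Y}L_y$ into subspaces for which there exists a map $f:Y\times Y\to Y$ with $[L_x,L_y]\subseteq L_{f(x,y)}$ for all $x,y\in Y$ (no group structure on $Y$ is assumed). Brackets are left-associative: $[x_1,\ldots,x_{k+1}]=[[x_1,\ldots,x_k],x_{k+1}]$. For a subspace $V\subseteq L$, $\operatorname{ad}_V^m(L)$ is the span of all $[a,b_1,\ldots,b_m]$ with $a\in L$ and $b_1,\ldots,b_m\in V$; for an element $v$, $\operatorname{ad}_v^m(L)$ is the set of all $[a,v,\ldots,v]$ ($m$ copies of $v$) with $a\in L$. Characteristic $0$ does not divide $m!$. Series: $L^1=L=L^{(0)}$, $L^{k+1}=[L^k,L]$, $L^{(k)}=[L^{(k-1)},L^{(k-1)}]$ for $k\in\mathbb{N}$. *)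

(* Defs.v *)
From HB Require Import structures.
From mathcomp Require Import all_boot all_algebra.
From mathcomp Require Import boolp classical_sets.

Set Implicit Arguments.
Unset Strict Implicit.
Unset Printing Implicit Defensive.

Import GRing.Theory.
Local Open Scope classical_set_scope.
Local Open Scope ring_scope.

HB.mixin Record Lmodule_isLieAlgebra (F : fieldType) L of GRing.Lmodule F L := {
  lie : L -> L -> L;
  lie_linearl : forall y, linear (fun x => lie x y);
  lie_linearr : forall x, linear (fun y => lie x y);
  liexx : forall x, lie x x = 0;
  lie_jacobi : forall x y z,
    lie (lie x y) z + lie (lie y z) x + lie (lie z x) y = 0
}.

#[short(type="lieAlgType")]
HB.structure Definition LieAlgebra (F : fieldType) :=
  {L of GRing.Lmodule F L & Lmodule_isLieAlgebra F L}.

Section LieAlgebraTheory.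
Variables (F : fieldType) (L : lieAlgType F).
Implicit Types (V W : set L) (a v : L).

Definition subspace V : Prop := submod_closed [in V].

Definition lspan (A : set L) : set L := smallest subspace A.

(* [V, W] is the span of the brackets, not just the set of brackets. *)
Definition lie_prod V W : set L := lspan [set lie x y | x in V & y in W].

(* The left-normed bracket [a, b_1, ..., b_k]. *)
Definition lnbracket a (bs : seq L) : L := foldl lie a bs.

(* ad_V^m(L), a subspace. *)
Definition ad_pow_subspace V (m : nat) : set L :=
  lspan [set x | exists a (bs : m.-tuple L),
                   (forall i, V (tnth bs i)) /\ x = lnbracket a bs].

(* ad_v^m(L), the bare set of values. *)
Definition ad_pow_elt v (m : nat) : set L :=
  [set lnbracket a (nseq m v) | a in setT].

(* The term L^k, numbered from L^1 = L; the value at k = 0 is junk (L). *)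
Definition lower_central (k : nat) : set L :=
  iter k.-1 (fun V => lie_prod V setT) setT.

(* The term L^(k), numbered from L^(0) = L. *)
Definition derived_series (k : nat) : set L :=
  iter k (fun V => lie_prod V V) setT.

(* The second clause is the direct sum decomposition; the third asks only for
   some map f on indices, with no group or semigroup law on Y. *)
Definition is_grading (Y : finType) (G : Y -> set L) : Prop :=
  [/\ forall y, subspace (G y),
      forall x, exists! c : {ffun Y -> L},
        (forall y, G y (c y)) /\ x = \sum_y c y
    & exists f : Y * Y -> Y,
        forall x y, lie_prod (G x) (G y) `<=` G (f (x, y))].

End LieAlgebraTheory.

Arguments lower_central {F} L k.
Arguments derived_series {F} L k.

(* Main.v *)
(** For an ideal V and D = L^(k), the operators ad_d (d in D) commute on V
    modulo the ideal [V, [D, D]]. As D is spanned by homogeneous elements, a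
    left-normed bracket of v in V with n m homogeneous elements of D can
    therefore be rearranged, modulo [V, [D, D]], so that m elements of the same
    component come first; under (a) it vanishes, and under (b) it does so after
    polarization. Hence bracketing V with L^(k) n m times lands in
    [V, L^(k+1)], and since this holds for every ideal V, it can be iterated:
    bracketing with L (n m)^s times lands in [V, L^(s)]. *)
Require Import Defs.
From mathcomp Require Import all_boot all_algebra.
From mathcomp Require Import boolp classical_sets.

Local Open Scope classical_set_scope.
Local Open Scope ring_scope.

Set Implicit Arguments.
Unset Strict Implicit.
Unset Printing Implicit Defensive.
Import GRing.Theory.

(** * Subspaces, products and ideals *)

Section Subspaces.
Variables (F : fieldType) (L : lieAlgType F).
Implicit Types (A B V W : set L) (x y z : L).

Lemma subspaceP V :
  subspace V <-> V 0 /\ forall a x y, V x -> V y -> V (a *: x + y).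
Proof.
split=> -[V0 VL]; split.
- by move: V0; rewrite inE.
- by move=> a x y Vx Vy; have := VL a x y; rewrite !inE; apply.
- by rewrite inE.
- by move=> a x y; rewrite !inE; apply: VL.
Qed.

Lemma subspaceT : subspace [set: L].
Proof. by apply/subspaceP. Qed.

Lemma subspaceZ V a x : subspace V -> V x -> V (a *: x).
Proof. by case/subspaceP=> V0 VL Vx; rewrite -[_ *: _]addr0; apply: VL. Qed.

Lemma subspaceD V x y : subspace V -> V x -> V y -> V (x + y).
Proof. by case/subspaceP=> V0 VL Vx Vy; rewrite -[x]scale1r; apply: VL. Qed.

Lemma subspace_sum V (I : Type) (r : seq I) (P : pred I) (E : I -> L) :
  subspace V -> (forall i, P i -> V (E i)) -> V (\sum_(i <- r | P i) E i).
Proof.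
move=> sV VE; apply: (big_ind V) => //; first by case/subspaceP: sV.
by move=> x y; apply: subspaceD.
Qed.

Lemma lspan_subspace A : subspace (lspan A).
Proof.
apply/subspaceP; split=> [|a x y Ax Ay] V [sV AV].
  by case/subspaceP: sV.
by case/subspaceP: (sV) => _; apply; [apply: Ax | apply: Ay].
Qed.

Lemma sub_lspan A : A `<=` lspan A.
Proof. exact: sub_smallest. Qed.

Lemma lspan_min A W : subspace W -> A `<=` W -> lspan A `<=` W.
Proof. by move=> sW AW x; apply. Qed.

Lemma lieDl x y z : lie (x + y) z = lie x z + lie y z.
Proof. by have := lie_linearl z 1 x y; rewrite !scale1r. Qed.

Lemma lieDr x y z : lie x (y + z) = lie x y + lie x z.
Proof. by have := lie_linearr x 1 y z; rewrite !scale1r. Qed.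

Lemma lie0l x : lie 0 x = 0.
Proof. by apply: (addrI (lie 0 x)); rewrite -lieDl !addr0. Qed.

Lemma lie0r x : lie x 0 = 0.
Proof. by apply: (addrI (lie x 0)); rewrite -lieDr !addr0. Qed.

Lemma lieNl x y : lie (- x) y = - lie x y.
Proof. by apply: (addrI (lie x y)); rewrite -lieDl !subrr lie0l. Qed.

Lemma lieC x y : lie x y = - lie y x.
Proof.
have := liexx (x + y); rewrite lieDl !lieDr !liexx add0r addr0.
by move/eqP; rewrite addr_eq0 => /eqP.
Qed.

(** The Jacobi identity in derivation form. Besides making products of ideals ideals, it gives the
    cost [lie x (lie y z)] of exchanging adjacent entries of a left-normed bracket. *)
Lemma lie_derivation x y z : lie (lie x y) z = lie (lie x z) y + lie x (lie y z).
Proof.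
have /eqP := lie_jacobi x y z; rewrite -addrA addr_eq0 => /eqP ->.
by rewrite opprD addrC [lie z x]lieC lieNl opprK [lie x (lie y z)]lieC.
Qed.

Lemma subspace_liel V y : subspace V -> subspace [set x | V (lie x y)].
Proof.
case/subspaceP=> V0 VL; apply/subspaceP; split=> [|a x z /= Vx Vz] /=.
  by rewrite lie0l.
by rewrite lie_linearl; apply: VL.
Qed.

Lemma subspace_lier V x : subspace V -> subspace [set y | V (lie x y)].
Proof.
case/subspaceP=> V0 VL; apply/subspaceP; split=> [|a y z /= Vy Vz] /=.
  by rewrite lie0r.
by rewrite lie_linearr; apply: VL.
Qed.

Lemma lie_lspan A B W : subspace W ->
    (forall x y, A x -> B y -> W (lie x y)) ->
  forall x y, lspan A x -> lspan B y -> W (lie x y).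
Proof.
move=> sW ABW x y Ax By.
apply: (lspan_min (subspace_liel y sW) _ Ax) => {Ax}x Ax /=.
apply: (lspan_min (subspace_lier x sW) _ By) => {By}y By /=.
exact: ABW.
Qed.

Lemma lie_prod_lie V W x y : V x -> W y -> lie_prod V W (lie x y).
Proof. by move=> Vx Wy; apply: sub_lspan; exists x => //; exists y. Qed.

Lemma lie_prod_min V W (U : set L) : subspace U ->
  (forall x y, V x -> W y -> U (lie x y)) -> lie_prod V W `<=` U.
Proof. by move=> sU VWU; apply: lspan_min => // z [x Vx [y Wy <-]]; apply: VWU. Qed.

Lemma lie_prodSl V V' W : V `<=` V' -> lie_prod V W `<=` lie_prod V' W.
Proof.
move=> VV'; apply: lie_prod_min; first exact: lspan_subspace.
by move=> x y /VV' V'x Wy; apply: lie_prod_lie.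
Qed.

(** One-sided closure suffices, since the bracket is antisymmetric. *)
Definition lie_ideal V := subspace V /\ forall x y, V x -> V (lie x y).

Lemma lie_idealT : lie_ideal [set: L].
Proof. by split=> //; apply: subspaceT. Qed.

Lemma lie_prod_ideal V W : lie_ideal V -> lie_ideal W -> lie_ideal (lie_prod V W).
Proof.
move=> [sV idV] [sW idW]; split=> [|x y VWx]; first exact: lspan_subspace.
have sVW : subspace (lie_prod V W) by apply: lspan_subspace.
apply: (lie_prod_min (subspace_liel y sVW) _ VWx) => {VWx}x z Vx Wz /=.
rewrite lie_derivation; apply: (subspaceD sVW).
  exact: lie_prod_lie (idV _ _ Vx) Wz.
exact: lie_prod_lie Vx (idW _ _ Wz).
Qed.

Lemma lie_prod_iter_ideal V W k : lie_ideal V -> lie_ideal W ->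
  lie_ideal (iter k (fun U => lie_prod U W) V).
Proof. by move=> idV idW; elim: k => //= k; move/lie_prod_ideal; apply. Qed.

Lemma derived_series_ideal k : lie_ideal (derived_series L k).
Proof.
elim: k => [|k IHk]; first exact: lie_idealT.
exact: lie_prod_ideal.
Qed.

End Subspaces.

(** * Left-normed brackets: multilinearity, rearrangement, polarization *)

Section LeftNormedBrackets.
Variables (F : fieldType) (L : lieAlgType F).
Implicit Types (V D : set L) (v x y : L) (bs : seq L).

Lemma lnbracketD v x bs :
  lnbracket (v + x) bs = lnbracket v bs + lnbracket x bs.
Proof. by elim: bs v x => //= b bs IHbs v x; rewrite lieDl IHbs. Qed.

Lemma lnbracket0 bs : lnbracket (0 : L) bs = 0.
Proof. by elim: bs => //= b bs; rewrite lie0l. Qed.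

Lemma lnbracket_sum (I : Type) (r : seq I) (P : pred I) (E : I -> L) bs :
  lnbracket (\sum_(i <- r | P i) E i) bs = \sum_(i <- r | P i) lnbracket (E i) bs.
Proof.
elim/big_rec2: _ => [|i y x _ <-]; first exact: lnbracket0.
exact: lnbracketD.
Qed.

Lemma lie_sumr (I : Type) (r : seq I) (P : pred I) (E : I -> L) v :
  lie v (\sum_(i <- r | P i) E i) = \sum_(i <- r | P i) lie v (E i).
Proof. elim/big_rec2: _ => [|i y x _ <-]; first exact: lie0r.
exact: lieDr. Qed.

Lemma lnbracket_ideal V v bs : lie_ideal V -> V v -> V (lnbracket v bs).
Proof. by move=> [_ idV]; elim: bs v => //= b bs IHbs v Vv; apply: IHbs; apply: idV. Qed.

(** Multilinearity: each entry from [D] is expanded over [B], while the initial entry stays an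
    arbitrary element of [V]. *)
Lemma lie_prod_iter_span V D (B : set L) k : subspace V -> D `<=` lspan B ->
  iter k (fun U => lie_prod U D) V `<=`
  lspan [set z | exists v bs, [/\ V v, size bs = k,
                 forall b, b \in bs -> B b & z = lnbracket v bs]].
Proof.
move=> sV DB; elim: k => [|k IHk] /=.
  by move=> v Vv; apply: sub_lspan; exists v, [::].
apply: lie_prod_min; first exact: lspan_subspace.
move=> x y /IHk Ax /DB By; apply: lie_lspan Ax By; first exact: lspan_subspace.
move=> _ b [v [bs [Vv <- Bbs ->]]] Bb; apply: sub_lspan.
exists v, (rcons bs b); split=> //; first by rewrite size_rcons.
- by move=> c; rewrite mem_rcons inE => /predU1P[-> //|]; apply: Bbs.
- by rewrite /lnbracket foldl_rcons.
Qed.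

Section Permutation.
Variables V D : set L.
Hypotheses (idV : lie_ideal V) (idD : lie_ideal D).
Let W := lie_prod V (lie_prod D D).

Let idW : lie_ideal W.
Proof. by apply: lie_prod_ideal => //; apply: lie_prod_ideal. Qed.

(** Moving [x] past one entry [y] changes the bracket by [lie v (lie y x)] followed by the remaining
    entries. This lies in [W], because [W] is an ideal. *)
Lemma lnbracket_move v s1 x s2 : V v -> D x -> (forall y, y \in s1 -> D y) ->
  W (lnbracket v (s1 ++ x :: s2) - lnbracket v (x :: s1 ++ s2)).
Proof.
have [sW _] := idW; have [_ brV] := idV.
elim: s1 v => [|y s1 IHs] v Vv Dx Ds /=.
  by rewrite subrr; case/subspaceP: sW.
have Dy : D y by apply: Ds; rewrite mem_head.
rewrite -[X in X - _](subrK (lnbracket (lie (lie v y) x) (s1 ++ s2))) -addrA.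
apply: (subspaceD sW).
  by apply: IHs => // [|z zs]; [apply: brV | apply: Ds; rewrite inE zs orbT].
rewrite lie_derivation lnbracketD addrC addKr.
by apply: (lnbracket_ideal _ idW); do 2?apply: lie_prod_lie.
Qed.

(** Induction on [s]: its head is moved to the front of [s'], then the tails are compared after the
    initial entry [lie v x]. *)
Lemma lnbracket_perm v s s' : V v -> (forall y, y \in s -> D y) ->
  perm_eq s s' -> W (lnbracket v s - lnbracket v s').
Proof.
have [sW _] := idW; have [_ brV] := idV.
elim: s s' v => [|x s IHs] s' v Vv Ds ss'.
  move: ss'; rewrite perm_sym => /perm_nilP ->.
  by rewrite subrr; case/subspaceP: sW.
have xs' : x \in s' by rewrite -(perm_mem ss') mem_head.
have Ds' y : y \in s' -> D y by rewrite -(perm_mem ss'); apply: Ds.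
case/splitPr: xs' ss' Ds' => s1 s2 ss' Ds'.
have {ss'}ss' : perm_eq s (s1 ++ s2).
  by move: ss'; rewrite (perm_sym _ (_ ++ _)) -cat1s perm_catCA /= perm_cons perm_sym.
have Dx : D x by apply: Ds; rewrite mem_head.
rewrite -[X in X - _](subrK (lnbracket v (x :: s1 ++ s2))) -addrA.
apply: (subspaceD sW).
  by apply: IHs => // [|z zs]; [apply: brV | apply: Ds; rewrite inE zs orbT].
rewrite -opprB -scaleN1r; apply: (subspaceZ _ sW); apply: lnbracket_move => //.
by move=> y ys1; apply: Ds'; rewrite mem_cat ys1.
Qed.

End Permutation.

Lemma lnbracket_nseq_sum (I : finType) (S : {set I}) (x : I -> L) v k :
  lnbracket v (nseq k (\sum_(i in S) x i)) =
  \sum_(t : k.-tuple I | all [in S] t) lnbracket v (map x t).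
Proof.
elim: k v => [|k IHk] v /=.
  rewrite (big_pred1 [tuple]) //= => t; rewrite tuple0 /=.
  by apply/esym/eqP.
rewrite lie_sumr lnbracket_sum (eq_bigr _ (fun i _ => IHk _)).
rewrite pair_big /=.
rewrite (reindex (fun p : I * k.-tuple I => cons_tuple p.1 p.2)) /=.
  by apply: eq_bigr => -[i t].
exists (fun t => (thead t, behead_tuple t)) => [[i t]|t] _ /=.
  by congr pair; apply/val_inj.
by rewrite [RHS]tuple_eta; apply/val_inj.
Qed.

(** Inclusion-exclusion with signs (-1)^(m - |S|) leaves only the tuples that use every index. It is
    an exact identity, with no reordering of entries. *)
Lemma lnbracket_polarization m (x : 'I_m -> L) v :
  \sum_(S : {set 'I_m}) (\prod_i (if i \in S then 1 else -1)) *: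
     lnbracket v (nseq m (\sum_(i in S) x i)) =
  \sum_(t : m.-tuple 'I_m | uniq t) lnbracket v (map x t).
Proof.
pose c (S : {set 'I_m}) : F := \prod_i (if i \in S then 1 else -1).
transitivity (\sum_(S : {set 'I_m}) \sum_(t : m.-tuple 'I_m)
    (if all [in S] t then c S *: lnbracket v (map x t) else 0)).
  apply: eq_bigr => S _; rewrite lnbracket_nseq_sum scaler_sumr.
  by rewrite [LHS]big_mkcond.
rewrite exchange_big [RHS]big_mkcond /=; apply: eq_bigr => t _.
(* By distributivity, the signed sum over the sets S containing the entries of [t] is a product: an
   index in S contributes 1, one outside S contributes 0 if it occurs in [t] and -1 otherwise. Any
   index missing from [t] gives a factor 1 - 1. *)
transitivity ((\prod_i (1 + (if i \in t then 0 else -1) : F)) *: lnbracket v (map x t)).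
  rewrite bigA_distr scaler_suml; apply: eq_bigr => S _.
  case: ifPn => [/allP tS|/allPn[i ti iS]].
    congr (_ *: _); apply: eq_bigr => i _; case: ifPn => // iS.
    by case: ifPn => // /tS; rewrite /= (negPf iS).
  by rewrite (bigD1 i) //= (negPf iS) ti mul0r scale0r.
case: ifPn => [ut|].
  have tT : t =i 'I_m.
    apply/subset_cardP; last exact: subset_predT.
    by rewrite (card_uniqP ut) size_tuple card_ord.
  by rewrite big1 ?scale1r // => i _; rewrite tT inE addr0.
move=> nut; have /existsP[i ti] : [exists i, i \notin t].
  apply: contraR nut; rewrite negb_exists => /forallP tT.
  apply/card_uniqP; rewrite size_tuple -[RHS]card_ord.
  by apply: eq_card => i; rewrite inE; have := tT i; rewrite negbK => ->.
by rewrite (bigD1 i) //= (negPf ti) subrr mul0r scale0r.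
Qed.

(* Modulo [V, [D, D]] all m! terms of the polarization identity are equal. *)
Lemma lnbracket_engel V D (A : set L) m : lie_ideal V -> lie_ideal D ->
    subspace A -> m`!%:R != 0 :> F ->
    (forall v a, A a -> lnbracket v (nseq m a) = 0) ->
  forall v s, V v -> size s = m -> (forall b, b \in s -> A b /\ D b) ->
  lie_prod V (lie_prod D D) (lnbracket v s).
Proof.
move=> idV idD sA m0 engA v s Vv /eqP szs ADs.
pose ts := Tuple szs; pose x i := tnth ts i.
set W := lie_prod _ _.
have sW : subspace W by apply: lspan_subspace.
have := lnbracket_polarization x v; rewrite big1 => [pol|S _]; last first.
  rewrite engA ?scaler0 //; apply: (subspace_sum _ sA) => i _.
  by have [] := ADs _ (mem_tnth i ts).
rewrite -[lnbracket v s](scalerK m0); apply: (subspaceZ _ sW).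
(* There are m! tuples without repetition, and by [pol] the brackets subtracted here sum to 0. *)
have -> : m`!%:R *: lnbracket v s =
    \sum_(t : m.-tuple 'I_m | uniq t) (lnbracket v s - lnbracket v (map x t)).
  rewrite sumrB -pol subr0 sumr_const scaler_nat; congr (_ *+ _).
  have := card_uniq_tuples m (mem 'I_m); rewrite card_ord ffactnn => <-.
  apply: eq_card => t; rewrite inE -[RHS]andTb; congr (_ && _).
  by apply/allP => i.
apply: (subspace_sum _ sW) => t ut; apply: lnbracket_perm => //.
  by move=> y /ADs[].
have -> : s = map x (enum 'I_m) by rewrite map_tnth_enum.
apply: perm_map; rewrite perm_sym; apply: uniq_perm (enum_uniq _) _ => //.
have tT : t =i 'I_m.
  apply/subset_cardP; last exact: subset_predT.
  by rewrite (card_uniqP ut) size_tuple card_ord.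
by move=> i; rewrite mem_enum tT.
Qed.

End LeftNormedBrackets.

(** Otherwise each label occurs at most m - 1 times, so [s] has at most |Y| (m - 1) entries, fewer
    than |Y| m. *)
Lemma pigeonhole_count (T : Type) (Y : finType) (l : T -> Y) (s : seq T) m :
  (0 < m)%N -> (0 < #|Y|)%N -> (size s = #|Y| * m)%N ->
  exists y, (m <= count (fun x => l x == y) s)%N.
Proof.
move=> m0 Y0 szs; apply/existsP; apply: contraT; rewrite negb_exists => /forallP lt_m.
have : (\sum_y count (fun x => l x == y) s <= \sum_(y : Y) m.-1)%N.
  by apply: leq_sum => y _; rewrite -ltnS prednK // ltnNge lt_m.
suff -> : (\sum_y count (fun x => l x == y) s = size s)%N.
  by rewrite szs sum_nat_const leq_pmul2l // leqNgt prednK ?leqnn.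
under eq_bigr do rewrite -sum1_count big_mkcond.
rewrite exchange_big -sum1_size /=; apply: eq_bigr => x _.
by rewrite -big_mkcond /= sum1_card (eq_card1 (x := l x)) // => y; rewrite inE eq_sym.
Qed.

(** * Graded Lie algebras and their derived series *)

Section Grading.
Variables (F : fieldType) (L : lieAlgType F) (Y : finType) (G : Y -> set L).
Hypothesis gradG : is_grading G.

Definition homogeneous : set L := [set x | exists y, G y x].

Lemma homogeneous_lie x y :
  homogeneous x -> homogeneous y -> homogeneous (lie x y).
Proof.
case: gradG => _ _ [f fG] [a Gax] [b Gby]; exists (f (a, b)).
by apply: fG; apply: lie_prod_lie.
Qed.

(** By bilinearity, brackets of elements of L^(k) expand into brackets of its homogeneous elements,
    and these are homogeneous because of the index map f. *)
Lemma derived_series_homogeneous k :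
  derived_series L k `<=` lspan (derived_series L k `&` homogeneous).
Proof.
elim: k => [|k IHk].
  case: gradG => _ dec _ x _; have [c [[Gc ->] _]] := dec x.
  apply: subspace_sum => [|y _]; first exact: lspan_subspace.
  by apply: sub_lspan; split=> //; exists y.
apply: lie_prod_min => [|x y /IHk Dx /IHk Dy]; first exact: lspan_subspace.
apply: lie_lspan Dx Dy; first exact: lspan_subspace.
move=> a b [Da Ha] [Db Hb]; apply: sub_lspan; split.
  exact: lie_prod_lie.
exact: homogeneous_lie.
Qed.

Variable m : nat.
Hypothesis m_gt0 : (0 < m)%N.
Hypothesis hyp : (forall y : Y, ad_pow_subspace (G y) m = [set 0])
        \/ ((forall (y : Y) (v : L), G y v -> ad_pow_elt v m = [set 0])
            /\ (forall p : nat, p \in [pchar F] -> ~~ (p %| m`!)%N)).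

Lemma lnbracket_component (V D : set L) y v s : lie_ideal V -> lie_ideal D ->
    V v -> size s = m -> (forall b, b \in s -> G y b /\ D b) ->
  lie_prod V (lie_prod D D) (lnbracket v s).
Proof.
move=> idV idD Vv szs GDs; case: hyp => [nilG|[engG charF]].
  have -> : lnbracket v s = 0.
    suff : ad_pow_subspace (G y) m (lnbracket v s) by rewrite nilG.
    apply: sub_lspan; move/eqP: szs => szs; exists v, (Tuple szs); split=> // i.
    by have [] := GDs _ (mem_tnth i (Tuple szs)).
  by case/subspaceP: (lspan_subspace [set lie x z | x in V & z in lie_prod D D]).
apply: (lnbracket_engel (A := G y) idV idD _ _ _ Vv szs GDs).
- by case: gradG.
(* If m! vanished in [F], the characteristic would be a prime dividing m!. *)
- apply/negP => mF0; have [p charp] := natf0_pchar (fact_gt0 m) mF0.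
  by have := charF p charp; rewrite (dvdn_pcharf charp) mF0.
move=> u a Ga; suff : ad_pow_elt a m (lnbracket u (nseq m a)) by rewrite (engG y).
by exists u.
Qed.

Lemma lie_prod_iter_derived V k : (0 < #|Y|)%N -> lie_ideal V ->
  iter (#|Y| * m) (fun U => lie_prod U (derived_series L k)) V `<=`
  lie_prod V (derived_series L k.+1).
Proof.
move=> Y0 idV; have idD := derived_series_ideal L k; set D := derived_series L k in idD *.
have idDD : lie_ideal (lie_prod D D) by apply: lie_prod_ideal.
have [sW idW] : lie_ideal (lie_prod V (lie_prod D D)) by apply: lie_prod_ideal.
apply: subset_trans (lie_prod_iter_span (proj1 idV)
  (@derived_series_homogeneous k)) _.
apply: lspan_min => // _ [v [bs [Vv szbs DHbs ->]]].
(* [y0] is a default label for elements that are not homogeneous. *)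
have [y0 _] : exists y0 : Y, y0 \in Y by apply/card_gt0P.
have [l lP] : exists l : L -> Y, forall x, homogeneous x -> G (l x) x.
  suff /choice : forall x, exists y, homogeneous x -> G y x by case=> l lP; exists l.
  move=> x; by have [[y Gyx]|nHx] := pselect (homogeneous x); [exists y | exists y0].
have [y le_m] := pigeonhole_count l m_gt0 Y0 szbs.
set P := fun x => l x == y in le_m.
pose s := filter P bs; pose r := filter (predC P) bs.
(* The first m entries labelled [y] go to the front; their bracket with [v] already lies in the
   target ideal, which absorbs all later entries. *)
have bsE : perm_eq bs (take m s ++ drop m s ++ r).
  by rewrite catA cat_take_drop perm_sym perm_filterC.
have Dbs b : b \in bs -> D b by case/DHbs.
rewrite -[lnbracket v bs](subrK (lnbracket v (take m s ++ drop m s ++ r))).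
apply: (subspaceD sW); first exact: lnbracket_perm.
rewrite [lnbracket v (_ ++ _)]foldl_cat.
apply: (lnbracket_ideal _ (conj sW idW)).
apply: (@lnbracket_component V D y) => //.
  by rewrite size_takel // size_filter.
move=> b /mem_take; rewrite mem_filter => /andP[/eqP <- /DHbs[Db Hb]].
by split=> //; apply: lP.
Qed.

(** Induction on [j] for all ideals [V] at once: the brackets are cut into |Y| m blocks of length
    (|Y| m)^j, each block is replaced by one bracket with L^(k+j), and the single-step inclusion is
    applied at level k + j. *)
Lemma lie_prod_iter_derived_exp V k j : (0 < #|Y|)%N -> lie_ideal V ->
  iter ((#|Y| * m) ^ j) (fun U => lie_prod U (derived_series L k)) V `<=`
  lie_prod V (derived_series L (k + j)).
Proof.
move=> Y0; have idD := derived_series_ideal L.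
elim: j V => [|j IHj] V idV; first by rewrite addn0.
rewrite expnS iterM addnS.
apply: subset_trans (lie_prod_iter_derived (k := k + j) Y0 idV).
move: (_ ^ j)%N IHj => N IHj; elim: (#|Y| * m)%N => //= t IHt.
apply: subset_trans (IHj _ _) (lie_prodSl IHt).
(* The induction hypothesis on [j] applies to what the first [t] blocks produce, as this is again an
   ideal. *)
by rewrite -iterM; apply: lie_prod_iter_ideal.
Qed.

End Grading.

Theorem proposition3p4 (m n s : nat) (m_gt0 : (0 < m)%N) (n_gt0 : (0 < n)%N)
    (s_gt0 : (0 < s)%N) (F : fieldType) (L : lieAlgType F)
    (Y : finType) (cardY : #|Y| = n) (G : Y -> set L) (gradG : is_grading G)
    (hyp : (forall y : Y, ad_pow_subspace (G y) m = [set 0])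
        \/ ((forall (y : Y) (v : L), G y v -> ad_pow_elt v m = [set 0])
            /\ (forall p : nat, p \in [pchar F] -> ~~ (p %| m`!)%N))) :
  lower_central L (1 + n ^ s * m ^ s)%N `<=` derived_series L s.
Proof.
subst n; rewrite -expnMn /lower_central add1n /=.
(* With k = 0 and V = L, the iterated product is the lower central term, since L^(0) = L. What
   remains is [L, L^(s)] inside L^(s). *)
have := lie_prod_iter_derived_exp gradG m_gt0 hyp (k := 0) (j := s) n_gt0
  (@lie_idealT F L).
move=> /subset_trans; apply.
have [sD idD] := derived_series_ideal L s.
apply: lie_prod_min => // x y _ Dy.
by rewrite lieC -scaleN1r; apply: (subspaceZ _ sD); apply: idD.
Qed.
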